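(* For the toothpick structure defined in the context, let $t(n)$ be the number of toothpicks added at stage $n$ ($n\ge1$), with $t(0)=0$. Then $t(1)=1$ and, for all $k\ge 1$, $$ t(2^k+i)=\begin{cases} 2^k, & i=0;\\ 2t(i)+t(i+1), & i=1,\ldots,2^k-1.\end{cases} $$
   Context: A toothpick is a line segment of length $1$ in the plane. The toothpick structure is built as follows. At stage $1$, place a single toothpick on the $y$-axis centered at the origin (from $(0,-\tfrac12)$ to $(0,\tfrac12)$). An end of a toothpick is exposed if that point of the plane is neither an end nor the midpoint of any other toothpick. At each subsequent stage, for every exposed toothpick end, place a toothpick centered at that end and perpendicular to the toothpick having that end. *)

(* Defs.v *)
From mathcomp Require Import all_boot all_order all_algebra finmap.

Set Implicit Arguments. Unset Strict Implicit. Unset Printing Implicit Defensive.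
Import GRing.Theory.
Local Open Scope ring_scope.
Local Open Scope fset_scope.

Section Toothpicks.
Variable R : realFieldType.

Definition point : choiceType := (R * R)%type.

(* The first toothpick lies on the y-axis and every later one is perpendicular
   to an earlier one, so all of them are parallel to an axis. A toothpick is
   therefore given by its midpoint and its direction: true for vertical, false
   for horizontal. *)
Definition toothpick : choiceType := (point * bool)%type.

Definition midpoint (s : toothpick) : point := s.1.
Definition vertical (s : toothpick) : bool := s.2.

Definition half_vector (s : toothpick) : R * R :=
  if vertical s then (0, 2^-1) else (2^-1, 0).

Definition ends (s : toothpick) : {fset point} :=
  [fset ((midpoint s - half_vector s)%R : point);
        ((midpoint s + half_vector s)%R : point)].

Definition exposed (S : {fset toothpick}) (s : toothpick) (p : point) : bool :=
  (p \in ends s) &&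
  all (fun s' => (p \notin ends s') && (p != midpoint s')) (S `\ s).

Definition new_toothpicks (S : {fset toothpick}) : {fset toothpick} :=
  [fset ((p, ~~ vertical s) : toothpick) | s in S, p in ends s & exposed S s p].

Definition first_toothpick : toothpick := ((0, 0), true).

(* All toothpicks present after stage n; there are none before stage 1. *)
Fixpoint structure_at (n : nat) : {fset toothpick} :=
  match n with
  | 0 => fset0
  | m.+1 => if m is 0 then [fset first_toothpick]
            else structure_at m `|` new_toothpicks (structure_at m)
  end.

Definition t (n : nat) : nat :=
  if n is m.+1 then #|` structure_at m.+1 `\` structure_at m| else 0%N.

End Toothpicks.

(* Main.v *)
(* After doubling coordinates all midpoints lie on the integer lattice, and a
   toothpick with midpoint (x, y) is vertical iff x + y is even. A cell thus has
   exactly two neighbours whose toothpick ends there, and it is born one stage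
   after the earlier of the two, unless both are born at the same stage (then it
   is never born). In the quadrant x, y >= 0 the birth time T has a closed
   recursion: with m = 2^k the scale of the cell (x, y),
     T(x, y) = 2m + T(x - m, y - m)           if x >= m and y >= m,
     T(x, y) = 2m + T(m - x, y - m)           if x < m < y,
     T(x, y) = 2m - 1 + T(m - y, x - m + 1)   if y < m <= x,
   so that from stage 2m on, the corner (m, m) spawns two copies of the quadrant
   and one copy that runs one stage ahead. Counting the cells with T = 2m + i
   gives 2 t(i) + t(i + 1). *)
Require Import Defs.
From mathcomp Require Import all_boot all_order all_algebra finmap.
From mathcomp Require Import zify.

Set Implicit Arguments. Unset Strict Implicit. Unset Printing Implicit Defensive.
Import GRing.Theory Num.Theory.

(** * Birth times: the local rule and the closed recursion *)

Definition shift (c : nat) (a : option nat) : option nat := omap (addn c) a.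

(* [None] stands for a cell that is never born. *)
Definition next_birth (a b : option nat) : option nat :=
  match a, b with
  | Some i, Some j => if i == j then None else Some (minn i j).+1
  | Some i, None | None, Some i => Some i.+1
  | None, None => None
  end.

(* [d] is fuel; the power of two is the largest m with m <= x or m < y. *)
Fixpoint birth_rec (d x y : nat) : option nat :=
  if d isn't d'.+1 then None else
  if x == 0 then (if y <= 1 then Some y.+1 else None) else
  if y == 0 then None else
  let m := 2 ^ trunc_log 2 (maxn x y.-1) in
  if y < m then shift (2 * m - 1) (birth_rec d' (m - y) (x - m).+1)
  else if x < m then shift (2 * m) (birth_rec d' (m - x) (y - m))
  else shift (2 * m) (birth_rec d' (x - m) (y - m)).

Definition birth (x y : nat) : option nat := birth_rec (x + y).+1 x y.
Arguments birth : simpl never.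

Lemma next_birthC a b : next_birth a b = next_birth b a.
Proof. by case: a b => [i|] [j|] //=; rewrite eq_sym minnC. Qed.

Lemma next_birth_id a : next_birth a a = None.
Proof. by case: a => //= i; rewrite eqxx. Qed.

Lemma next_birth_shift c a b :
  next_birth (shift c a) (shift c b) = shift c (next_birth a b).
Proof.
case: a b => [i|] [j|] //=; rewrite ?addnS // eqn_add2l.
by case: eqP => //= _; rewrite -addn_minr addnS.
Qed.

Lemma next_birth_lt i b :
  (forall j, b = Some j -> i < j) -> next_birth (Some i) b = Some i.+1.
Proof.
case: b => //= j /(_ _ erefl) ij.
by rewrite ltn_eqF // (minn_idPl (ltnW ij)).
Qed.

Lemma shiftD c d a : shift c (shift d a) = shift (c + d) a.
Proof. by case: a => //= i; rewrite addnA. Qed.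

Lemma trunc_log_max_bounds x y : 0 < x ->
  let m := 2 ^ trunc_log 2 (maxn x y.-1) in
  [/\ 0 < m, x < 2 * m, y <= 2 * m & (m <= x) || (m < y)].
Proof.
move=> x0 m; have h : 0 < maxn x y.-1 by lia.
have /andP[] := trunc_log_bounds (isT : 1 < 2) h.
rewrite expnS -/m; move: (m) => n h1 h2; split; lia.
Qed.

(** Every recursive call strictly lowers the coordinate sum. *)
Lemma birth_rec_fuel d e x y :
  x + y < d -> x + y < e -> birth_rec d x y = birth_rec e x y.
Proof.
elim: d e x y => [|d IH] [|e] x y //= hd he.
have [//|x0] := eqVneq x 0; have [//|y0] := eqVneq y 0.
have := @trunc_log_max_bounds x y; rewrite lt0n x0 => /(_ isT).
move: (2 ^ _) => m /= [m0 xm ym mxy].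
case: ifP => ?; first by congr shift; apply: IH; lia.
by case: ifP => ?; congr shift; apply: IH; lia.
Qed.

Lemma birth0 y : birth 0 y = if y <= 1 then Some y.+1 else None.
Proof. by []. Qed.

Lemma birth_x0 x : 0 < x -> birth x 0 = None.
Proof. by case: x. Qed.

Lemma birth_step k x y : let m := 2 ^ k in
  0 < x < 2 * m -> 0 < y <= 2 * m -> (m <= x) || (m < y) ->
  birth x y = if y < m then shift (2 * m - 1) (birth (m - y) (x - m).+1)
  else if x < m then shift (2 * m) (birth (m - x) (y - m))
  else shift (2 * m) (birth (x - m) (y - m)).
Proof.
move=> m /andP[x0 xm] /andP[y0 ym] mxy; rewrite {1}/birth /=.
rewrite -{1}[x == 0]negbK -lt0n x0 -[y == 0]negbK -lt0n y0 /=.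
have -> : trunc_log 2 (maxn x y.-1) = k.
  apply: trunc_log_eq => //; rewrite expnS -/m; move: m xm ym mxy => m; lia.
rewrite -/m; move: (expn_gt0 2 k); rewrite -/m /= => m0.
case: ifP => ?; first by congr shift; apply: birth_rec_fuel; lia.
by case: ifP => ?; congr shift; apply: birth_rec_fuel; lia.
Qed.

(** * Unfolding at a given scale, in the three outer blocks *)

Section Scale.
Variable k : nat.
Let m := 2 ^ k.

Lemma birth_ne x y : m <= x < 2 * m -> m <= y <= 2 * m ->
  birth x y = shift (2 * m) (birth (x - m) (y - m)).
Proof.
have m0 : 0 < m by rewrite expn_gt0.
move=> hx hy; rewrite (@birth_step k); rewrite -/m; try lia.
by do 2![rewrite ifF; last by lia].
Qed.

(** On the column [x = m] the recursion takes its last branch, but there [m - x] and [x - m] are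
    both 0, so the reflected formula still applies. *)
Lemma birth_nw x y : 0 < x <= m -> m < y <= 2 * m ->
  birth x y = shift (2 * m) (birth (m - x) (y - m)).
Proof.
have m0 : 0 < m by rewrite expn_gt0.
move=> hx hy; rewrite (@birth_step k); rewrite -/m; try lia.
rewrite ifF; last by lia.
by case: ltnP => // h; congr (shift _ _); congr birth; lia.
Qed.

Lemma birth_se x y : m <= x < 2 * m -> 0 < y <= m ->
  birth x y = shift (2 * m - 1) (birth (m - y) (x - m).+1).
Proof.
have m0 : 0 < m by rewrite expn_gt0.
move=> hx hy; rewrite (@birth_step k); rewrite -/m; try lia.
case: ltnP => // ym; rewrite ifF; last by lia.
(* The row [y = m] takes the last branch. Both formulas give [Some (2 * m + 1)] at the corner and
   [None] to its right. *)
have -> : y = m by lia.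
rewrite subnn birth0.
have [->|xm] := eqVneq x m; first by rewrite subnn /=; congr Some; lia.
by rewrite birth_x0 ?ifF //; lia.
Qed.

End Scale.

(** * Bounds on birth times and values along the border of a block *)

Lemma pow2_cases k : 2 ^ k = 1 \/ exists2 j, 2 ^ k = 2 * 2 ^ j & 0 < 2 ^ j.
Proof.
by case: k => [|k]; [left | right; exists k; rewrite ?expnS ?expn_gt0].
Qed.

Lemma birth_scale x y : 0 < x -> 0 < y -> exists k,
  [/\ x < 2 * 2 ^ k, y <= 2 * 2 ^ k, (2 ^ k <= x) || (2 ^ k < y) &
      forall j, (2 ^ j <= x) || (2 ^ j < y) -> 2 ^ j <= 2 ^ k].
Proof.
move=> x0 y0; exists (trunc_log 2 (maxn x y.-1)).
have [_ h1 h2 h3] := @trunc_log_max_bounds x y x0; split=> // j hj.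
rewrite leq_exp2l //; apply: trunc_log_max => //; lia.
Qed.

Lemma birth_rec_gt0 d x y n : birth_rec d x y = Some n -> 0 < n.
Proof.
elim: d x y n => //= d IH x y n.
case: ifP => _; first by case: ifP => // _ [<-].
case: ifP => // _.
by do 2?case: ifP => _; case E: birth_rec => [i|] //= [<-];
  rewrite addn_gt0 (IH _ _ _ E) orbT.
Qed.

Lemma birth_gt0 x y n : birth x y = Some n -> 0 < n.
Proof. exact: birth_rec_gt0. Qed.

Lemma birth_gt1 x y n : 0 < y -> birth x y = Some n -> 1 < n.
Proof.
case: x => [|x] y0; first by rewrite birth0; case: ifP => // _ [<-].
have [k [h1 h2 h3 _]] := birth_scale (ltn0Sn x) y0.
have m0 : 0 < 2 ^ k by rewrite expn_gt0.
rewrite (birth_step _ _ h3) ?y0 //.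
by do 2?case: ifP => _; case E: birth => [i|] //= [<-];
  have := birth_gt0 E; lia.
Qed.

(** Together with [birth_le]: among the cells with positive coordinates that are ever born, the
    block [x < 2 ^ k], [y <= 2 ^ k] holds exactly those born by stage [2 * 2 ^ k]. *)
Lemma birth_gt k x y n : 0 < x -> 0 < y -> (2 ^ k <= x) || (2 ^ k < y) ->
  birth x y = Some n -> 2 * 2 ^ k < n.
Proof.
move=> x0 y0 kxy; have [j [h1 h2 h3 /(_ _ kxy)]] := birth_scale x0 y0.
have : 0 < 2 ^ k by rewrite expn_gt0.
rewrite (birth_step _ _ h3) ?x0 ?y0 //.
case: ifP => _ hk hkj; first case E: birth => [i|] //= [<-].
  (* The turned copy is shifted by only [2m - 1], so its cell must be born at stage 2 or later; its
     second coordinate is positive. *)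
  by have := birth_gt1 _ E; lia.
by case: ifP => _; case E: birth => [i|] //= [<-]; have := birth_gt0 E; lia.
Qed.

Lemma birth_le k x y n : x < 2 ^ k -> y <= 2 ^ k ->
  birth x y = Some n -> n <= 2 * 2 ^ k.
Proof.
elim: k x y n => [|k IH] x y n.
  rewrite expn0 ltnS leqn0 => /eqP -> y1; rewrite birth0 y1 => -[<-].
  by rewrite muln1.
have m0 : 0 < 2 ^ k by rewrite expn_gt0.
rewrite expnS => xm ym.
have [->|x0] := posnP x; first by rewrite birth0; case: ifP => // _ [<-]; lia.
have [->|y0] := posnP y; first by rewrite birth_x0.
have [h|] := boolP ((2 ^ k <= x) || (2 ^ k < y)); last first.
  by move=> h /IH; lia.
rewrite (birth_step _ _ h) ?x0 ?y0 //.
by do 2?case: ifP => ?; case E: birth => [i|] //= [<-];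
  have := IH _ _ _ _ _ E; lia.
Qed.

(** Near the border of a block an input can lie outside it, where transport from a smaller copy
    breaks down. This lemma and the next three supply the explicit values needed on the last two
    rows and columns. *)
Lemma birth_top k x : 0 < x < 2 ^ k ->
  birth x (2 ^ k) = if odd x then Some (2 * 2 ^ k) else None.
Proof.
elim: k x => [|k IH] x; first by rewrite expn0; lia.
have m0 : 0 < 2 ^ k by rewrite expn_gt0.
rewrite expnS => hx; have [h|h] := ltnP x (2 ^ k).
  rewrite (@birth_nw k); [|lia..].
  have -> : 2 * 2 ^ k - 2 ^ k = 2 ^ k by lia.
  rewrite IH; last by lia.
  have [k1|[j k1 _]] := pow2_cases k; first by lia.
  have -> : odd (2 ^ k - x) = odd x by lia.
  by case: ifP => //= _; congr Some; lia.
rewrite (@birth_ne k); [|lia..].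
have -> : 2 * 2 ^ k - 2 ^ k = 2 ^ k by lia.
have [k1|[j k1 j0]] := pow2_cases k.
  by rewrite k1; have -> : x = 1 by lia.
have [->|hx1] := eqVneq x (2 ^ k).
  by rewrite subnn birth0 !ifF //; lia.
rewrite IH; last by lia.
have -> : odd (x - 2 ^ k) = odd x by lia.
by case: ifP => //= _; congr Some; lia.
Qed.

Lemma birth_below_top k x : odd x -> x < 2 ^ k ->
  birth x (2 ^ k - 1) = Some (2 * 2 ^ k - 1).
Proof.
elim: k x => [|k IH] x; first by rewrite expn0; lia.
have m0 : 0 < 2 ^ k by rewrite expn_gt0.
rewrite expnS => ox hx.
have [k1|[j k1 j0]] := pow2_cases k.
  by rewrite k1; have -> : x = 1 by lia.
have e : 2 * 2 ^ k - 1 - 2 ^ k = 2 ^ k - 1 by lia.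
have [h|h] := ltnP x (2 ^ k).
  by rewrite (@birth_nw k) ?e ?IH /=; [congr Some|..]; lia.
by rewrite (@birth_ne k) ?e ?IH /=; [congr Some|..]; lia.
Qed.

(** The south-east copy is turned, so the lower half of the last column is read off the top row of
    the smaller block. *)
Lemma birth_right k x y : x = 2 ^ k - 1 -> 0 < x + y -> y < 2 ^ k ->
  birth x y = if odd y then Some (2 * 2 ^ k - 1) else None.
Proof.
elim: k x y => [|k IH] x y; first by rewrite expn0; lia.
have m0 : 0 < 2 ^ k by rewrite expn_gt0.
rewrite expnS => -> _ hy.
have [k1|[j k1 j0]] := pow2_cases k.
  by rewrite k1 in hy *; case: y hy => [|[|]].
have [->|y0] := posnP y; first by rewrite birth_x0 //; lia.
have [h|h] := leqP (2 ^ k) y.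
  rewrite (@birth_ne k) ?IH; [|lia..].
  have -> : odd (y - 2 ^ k) = odd y by lia.
  by case: ifP => //= _; congr Some; lia.
rewrite (@birth_se k); [|lia..].
have -> : (2 * 2 ^ k - 1 - 2 ^ k).+1 = 2 ^ k by lia.
rewrite birth_top; last by lia.
have -> : odd (2 ^ k - y) = odd y by lia.
by case: ifP => //= _; congr Some; lia.
Qed.

Lemma birth_right2 k x y : 0 < k -> x = 2 ^ k - 2 -> odd y -> y < 2 ^ k ->
  birth x y = Some (2 * 2 ^ k - 2).
Proof.
case: k => // k _; elim: k x y => [|k IH] x y.
  by rewrite expn1 => ->; case: y => [|[|]].
have j0 : 0 < 2 ^ k by rewrite expn_gt0.
have k1 := expnS 2 k.
rewrite (expnS 2 k.+1) => -> oy hy.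
have [h|h] := leqP (2 ^ k.+1) y.
  by rewrite (@birth_ne k.+1) ?IH /=; [congr Some|..]; lia.
rewrite (@birth_se k.+1); [|lia..].
have -> : (2 * 2 ^ k.+1 - 2 - 2 ^ k.+1).+1 = 2 ^ k.+1 - 1 by lia.
by rewrite birth_below_top /=; [congr Some|..]; lia.
Qed.

(** * The closed recursion obeys the local birth rule *)

(** At a common scale both sides unfold to the same cell, with shifts [2m] and [2m - 1]. This makes
    the inputs above and below the seam [y = m] to the right of the corner simultaneous, so that no
    cell is born there. *)
Lemma birth_col1 u : birth 1 u.+1 = shift 1 (birth u 1).
Proof.
case: u => // u.
have [k [h1 _ h3 _]] := birth_scale (ltn0Sn u) (ltn0Sn 0).
have m0 : 0 < 2 ^ k by rewrite expn_gt0.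
have [k1|[j k1 j0]] := pow2_cases k; first by have -> : u = 0 by lia.
rewrite (@birth_nw k) 1?(@birth_se k u.+1) ?shiftD; [|lia..].
by congr shift; [lia | congr birth; lia].
Qed.

(* [|x - 1|]: by symmetry the cell [(-1, y)] has the birth time of [(1, y)]. *)
Definition dec_abs (x : nat) : nat := x.-1 + (x == 0).

Lemma dec_abs_pred x : 0 < x -> dec_abs x = x.-1.
Proof. by case: x => // x _; rewrite /dec_abs addn0. Qed.

(** A horizontal toothpick (odd sum) grows from vertical ones below and above it, a vertical one
    from horizontal ones to its left and right. *)
Definition birth_local_at (x y : nat) : Prop :=
  birth x y = if odd (x + y) then next_birth (birth x (dec_abs y)) (birth x y.+1)
              else next_birth (birth (dec_abs x) y) (birth x.+1 y).

Lemma birth_local_x0 y : 0 < y -> birth_local_at 0 y.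
Proof.
rewrite /birth_local_at (next_birth_id (birth 1 y)) => y0.
by rewrite dec_abs_pred //; case: y y0 => [|[|[|y]]] // _; case: ifP.
Qed.

Lemma birth_local_y0 x : 0 < x -> birth_local_at x 0.
Proof.
case: x => // x _; rewrite /birth_local_at next_birth_id.
case: x => [|x]; first by [].
by rewrite !birth_x0 //; case: ifP.
Qed.

Lemma birth_local_top k x : 0 < k -> 0 < x < 2 ^ k -> birth_local_at x (2 ^ k).
Proof.
move=> k0 hx; rewrite /birth_local_at birth_top //.
have k1 : odd (2 ^ k) = false by rewrite oddX; lia.
rewrite oddD k1 addbF !dec_abs_pred; [|lia..].
case: ifP => ox.
  rewrite -subn1 birth_below_top //; last by lia.
  rewrite next_birth_lt; first by congr Some; lia.
  by move=> j /(@birth_gt k); lia.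
rewrite !birth_top; [|lia..].
have [-> ->] : odd x.-1 /\ odd x.+1 by lia.
by rewrite next_birth_id.
Qed.

Lemma birth_local_right k x y : 0 < k -> x = 2 ^ k - 1 -> 0 < y < 2 ^ k ->
  odd y -> birth_local_at x y.
Proof.
move=> k0 ex hy oy; have k1 : odd (2 ^ k) = false by rewrite oddX; lia.
rewrite /birth_local_at (birth_right ex) ?oy; [|lia..].
rewrite ifF ?dec_abs_pred; [|lia..].
rewrite (@birth_right2 k) //; [|lia..].
rewrite next_birth_lt; first by congr Some; lia.
by move=> j /(@birth_gt k); lia.
Qed.

(** Since [2 ^ k] is even, reflection keeps the parity, and [next_birth] commutes with shifts; the
    rule is thus inherited from the copy, except where an input leaves it. *)
Lemma birth_local_nw k x y : 0 < k -> 0 < x < 2 ^ k -> 2 ^ k < y < 2 * 2 ^ k ->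
  birth_local_at (2 ^ k - x) (y - 2 ^ k) -> birth_local_at x y.
Proof.
move=> k0 hx hy; have : odd (2 ^ k) = false by rewrite oddX; lia.
have [mE|[j mE j0] m2] := pow2_cases k; first by lia.
rewrite /birth_local_at !dec_abs_pred; [|lia..].
have -> : odd (2 ^ k - x + (y - 2 ^ k)) = odd (x + y) by lia.
rewrite (@birth_nw k x y); [|lia..].
case: ifP => oxy L.
  rewrite L -next_birth_shift (@birth_nw k x y.+1); [|lia..].
  have -> : y.+1 - 2 ^ k = (y - 2 ^ k).+1 by lia.
  (* The lower input lies on the row [2 ^ k] at an even [x], hence is never born, like the matching
     axis cell of the copy. *)
  have [y1|y1] := eqVneq y (2 ^ k).+1.
    have -> : (y - 2 ^ k).-1 = 0 by lia.
    have -> : y.-1 = 2 ^ k by lia.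
    by rewrite birth_top ?ifF ?birth_x0 //; lia.
  rewrite (@birth_nw k x y.-1); [|lia..].
  by have -> : y.-1 - 2 ^ k = (y - 2 ^ k).-1 by lia.
rewrite (@birth_nw k x.+1); [|lia..].
have -> : 2 ^ k - x.+1 = (2 ^ k - x).-1 by lia.
(* The left input is on the y-axis, too high to be born, so the right input alone decides. *)
have [x1|x1] := eqVneq x 1.
  rewrite (birth_right (k := k)) ?ifT; [|lia..].
  rewrite (@birth_right2 k _ (y - 2 ^ k)) /=; [|lia..].
  by rewrite x1 birth0 ifF /=; [congr Some|]; lia.
rewrite L -next_birth_shift next_birthC (@birth_nw k x.-1); [|lia..].
by have -> : 2 ^ k - x.-1 = (2 ^ k - x).+1 by lia.
Qed.

(** The implication excludes even cells of the last column, whose right input lies beyond the block;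
    [birth_local_right] covers them. *)
Lemma birth_local_ne k x y : 0 < k -> 2 ^ k <= x < 2 * 2 ^ k ->
  2 ^ k <= y < 2 * 2 ^ k -> ~~ odd (x + y) ==> (x != 2 * 2 ^ k - 1) ->
  ((0 < x - 2 ^ k + (y - 2 ^ k)) -> birth_local_at (x - 2 ^ k) (y - 2 ^ k)) ->
  birth_local_at x y.
Proof.
move=> k0 hx hy; have : odd (2 ^ k) = false by rewrite oddX; lia.
have [mE|[j mE j0] m2] := pow2_cases k; first by lia.
rewrite /birth_local_at (dec_abs_pred (x := x)) ?(dec_abs_pred (x := y)); [|lia..].
have -> : odd (x - 2 ^ k + (y - 2 ^ k)) = odd (x + y) by lia.
rewrite (@birth_ne k x y); [|lia..].
case: ifP => /= oxy hx1 L.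
  rewrite (@birth_ne k x y.+1); [|lia..].
  have -> : y.+1 - 2 ^ k = (y - 2 ^ k).+1 by lia.
  have [y1|y1] := eqVneq y (2 ^ k).
    rewrite y1 subnn (@birth_se k x (2 ^ k).-1); [|lia..].
    have -> : 2 ^ k - (2 ^ k).-1 = 1 by lia.
    rewrite birth_col1 shiftD subnK; last by lia.
    by rewrite next_birth_id birth_x0 //; lia.
  rewrite L -?next_birth_shift; last by lia.
  rewrite (@birth_ne k x y.-1); [|lia..].
  have -> : y.-1 - 2 ^ k = (y - 2 ^ k).-1 by lia.
  by rewrite dec_abs_pred //; lia.
rewrite (@birth_ne k x.+1); [|lia..].
have -> : x.+1 - 2 ^ k = (x - 2 ^ k).+1 by lia.
have [xm|xm] := eqVneq x (2 ^ k); last first.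
  rewrite L -?next_birth_shift; last by lia.
  rewrite (@birth_ne k x.-1); [|lia..].
  have -> : x.-1 - 2 ^ k = (x - 2 ^ k).-1 by lia.
  by rewrite dec_abs_pred //; lia.
(* The corner [(m, m)] is the seed of the copy: its left input is born at stage [2m], its right
   input never. *)
have [ym|ym] := eqVneq y (2 ^ k).
  rewrite xm ym subnn birth0 birth_x0 // birth_top ?ifT /=; [|lia..].
  by congr Some; lia.
(* Left of the seam [x = m] lies the reflected copy, so the left input reads as column 1 of the
   copy, in agreement with [dec_abs 0 = 1]. *)
rewrite L -?next_birth_shift; last by lia.
rewrite xm subnn (@birth_nw k (2 ^ k).-1); [|lia..].
by have -> : 2 ^ k - (2 ^ k).-1 = 1 by lia.
Qed.

(** The quarter turn and the extra 1 flip the parity, so vertical and horizontal inputs change roles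
    when the rule is transported. *)
Lemma birth_local_se k x y : 0 < k -> 2 ^ k <= x < 2 * 2 ^ k ->
  0 < y < 2 ^ k -> ~~ odd (x + y) ==> (x != 2 * 2 ^ k - 1) ->
  birth_local_at (2 ^ k - y) (x - 2 ^ k).+1 -> birth_local_at x y.
Proof.
move=> k0 hx hy; have : odd (2 ^ k) = false by rewrite oddX; lia.
have [mE|[j mE j0] m2] := pow2_cases k; first by lia.
rewrite /birth_local_at !dec_abs_pred; [|lia..].
have -> : odd (2 ^ k - y + (x - 2 ^ k).+1) = ~~ odd (x + y) by lia.
rewrite (@birth_se k x y); [|lia..].
case: (boolP (odd (x + y))) => /= oxy hx1 L.
  rewrite (@birth_se k x y.+1); [|lia..].
  have -> : 2 ^ k - y.+1 = (2 ^ k - y).-1 by lia.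
  have [y1|y1] := eqVneq y 1.
    rewrite y1 birth_x0; last by lia.
    rewrite (birth_right (k := k)) ?ifT; [|lia..].
    rewrite (@birth_right2 k) /=; [|lia..].
    by congr Some; lia.
  rewrite L -next_birth_shift next_birthC (@birth_se k x y.-1); [|lia..].
  by have -> : 2 ^ k - y.-1 = (2 ^ k - y).+1 by lia.
rewrite L -next_birth_shift (@birth_se k x.+1); [|lia..].
have -> : (x.+1 - 2 ^ k).+1 = (x - 2 ^ k).+2 by lia.
have [xm|xm] := eqVneq x (2 ^ k).
  rewrite xm subnn /= birth_x0; last by lia.
  by rewrite (@birth_right k (2 ^ k).-1) ?ifF; [|lia..].
rewrite (@birth_se k x.-1); [|lia..].
by have -> : (x.-1 - 2 ^ k).+1 = (x - 2 ^ k).+1.-1 by lia.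
Qed.

(** Strong induction on [x + y], as the copies have smaller sums. The axes, the top row and the even
    cells of the last column are treated directly; the origin is the seed and obeys no rule. *)
Lemma birth_local x y : 0 < x + y -> birth_local_at x y.
Proof.
have [n] := ubnP (x + y); elim: n x y => // n IH x y hn hxy.
have [x0|x0] := posnP x; first by rewrite x0; apply: birth_local_x0; lia.
have [y0|y0] := posnP y; first by rewrite y0; apply: birth_local_y0; lia.
have [k [h1 h2 h3 _]] := birth_scale x0 y0.
have m0 : 0 < 2 ^ k by rewrite expn_gt0.
have e := expnS 2 k.
have [->|y2] := eqVneq y (2 ^ k.+1); first by apply: birth_local_top => //; lia.
(* At scale 1 the parity arguments fail, but only the cell [(1, 1)] is left. *)
have [k0|k0] := posnP k.
  rewrite k0 ?expn0 ?expn1 in h1 h2 h3 y2.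
  by have [-> ->] : x = 1 /\ y = 1 by lia.
have m2 : odd (2 ^ k) = false by rewrite oddX; lia.
have [/andP[ox /eqP xm]|hx1] :=
    boolP (~~ odd (x + y) && (x == 2 * 2 ^ k - 1)).
  by apply: (@birth_local_right k.+1); lia.
have [xm|xm] := ltnP x (2 ^ k).
  by apply: (@birth_local_nw k); try apply: IH; lia.
have [ym|ym] := ltnP y (2 ^ k).
  by apply: (@birth_local_se k); try apply: IH; lia.
by apply: (@birth_local_ne k); try (move=> ?; apply: IH); lia.
Qed.

(** * Counting births in the open quadrant *)

Lemma shift_eq c a i : (shift c a == Some (c + i)) = (a == Some i).
Proof. by case: a => //= j; rewrite /eq_op /= eqn_add2l. Qed.

Lemma birth_gt2 x y n : 0 < x -> 0 < y -> birth x y = Some n -> 2 < n.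
Proof. by move=> x0 y0 /(@birth_gt 0) -> //; rewrite x0. Qed.

Definition quadrant_count (X Y n : nat) : nat :=
  \sum_(1 <= x < X) \sum_(1 <= y < Y) (birth x y == Some n).

Lemma quadrant_count_stable k X Y n : 2 ^ k <= X -> 2 ^ k < Y ->
  n <= 2 * 2 ^ k -> quadrant_count X Y n = quadrant_count (2 ^ k) (2 ^ k).+1 n.
Proof.
have m0 : 0 < 2 ^ k by rewrite expn_gt0.
move=> hX hY hn; rewrite /quadrant_count (big_cat_nat _ (n := 2 ^ k)) //=.
rewrite [X in _ + X]big_nat_cond [X in _ + X]big1 ?addn0 => [|x hx]; last first.
  rewrite big_nat_cond big1 // => y hy; case: eqP => // /(@birth_gt k); lia.
apply: eq_big_nat => x hx; rewrite (big_cat_nat _ (n := (2 ^ k).+1)) //=.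
rewrite [X in _ + X]big_nat_cond [X in _ + X]big1 ?addn0 // => y hy.
case: eqP => // /(@birth_gt k); lia.
Qed.

Lemma quadrant_count_small X Y n : n <= 2 -> quadrant_count X Y n = 0.
Proof.
move=> hn; rewrite /quadrant_count big_nat_cond big1 // => x hx.
rewrite big_nat_cond big1 // => y hy.
case: eqP => // /birth_gt2; lia.
Qed.

Section Recurrence.
Variables k i : nat.
Hypothesis i_gt0 : 0 < i.
Let m := 2 ^ k.

Let m_gt0 : 0 < m. Proof. by rewrite expn_gt0. Qed.

Lemma count_base : quadrant_count m m.+1 (2 * m + i) = 0.
Proof.
rewrite /quadrant_count big_nat_cond big1 // => x hx.
rewrite big_nat_cond big1 // => y hy.
case: eqP => // /(@birth_le k); rewrite -/m; lia.
Qed.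

Lemma count_nw : \sum_(1 <= x < m) \sum_(m.+1 <= y < (2 * m).+1)
  (birth x y == Some (2 * m + i)) = quadrant_count m m.+1 i.
Proof.
rewrite big_nat_rev /=; apply: eq_big_nat => x hx.
rewrite -(add1n m) big_addn; have -> : (2 * m).+1 - m = m.+1 by lia.
apply: eq_big_nat => y hy; rewrite (@birth_nw k) -/m; [|lia..].
by rewrite shift_eq; congr (nat_of_bool (birth _ _ == _)); lia.
Qed.

(** The turn maps this rectangle bijectively onto the positive cells of the smaller block, and the
    shift [2m - 1] turns the target [2m + i] into [i + 1]. *)
Lemma count_se : \sum_(m <= x < 2 * m) \sum_(1 <= y < m)
  (birth x y == Some (2 * m + i)) = quadrant_count m m.+1 i.+1.
Proof.
rewrite exchange_big_nat /= big_nat_rev /=; apply: eq_big_nat => y hy.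
rewrite -{1}[m](add0n m) big_addn; have -> : 2 * m - m = m by lia.
rewrite [RHS]big_add1 /=; apply: eq_big_nat => x hx.
rewrite (@birth_se k) -/m; [|lia..].
have -> : 2 * m + i = 2 * m - 1 + i.+1 by lia.
by rewrite shift_eq; congr (nat_of_bool (birth _ _ == _)); lia.
Qed.

Lemma count_axis : \sum_(0 <= y < m.+1) (birth 0 y == Some i) = (i == 1) + (i == 2).
Proof.
rewrite big_nat_recl // (big_ltn m_gt0) big_nat_cond big1 => [|y hy].
  by rewrite !birth0 /= addn0 !(eq_sym i).
by rewrite birth0 ifF //; lia.
Qed.

(** This copy brings along its own axes: its column 0 has births 1 and 2 only, and its row 0 nothing
    beyond the corner. *)
Lemma count_ne : \sum_(m <= x < 2 * m) \sum_(m <= y < (2 * m).+1)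
  (birth x y == Some (2 * m + i)) =
  quadrant_count m m.+1 i + (i == 1) + (i == 2).
Proof.
transitivity (\sum_(0 <= x < m) \sum_(0 <= y < m.+1) (birth x y == Some i)).
  rewrite -{1}[m](add0n m) big_addn; have -> : 2 * m - m = m by lia.
  apply: eq_big_nat => x hx.
  rewrite -{1}[m](add0n m) big_addn; have -> : (2 * m).+1 - m = m.+1 by lia.
  apply: eq_big_nat => y hy; rewrite (@birth_ne k) -/m; [|lia..].
  by rewrite shift_eq !addnK.
rewrite (big_ltn m_gt0) count_axis addnC -addnA; congr (_ + _).
apply: eq_big_nat => x hx; rewrite big_ltn // birth_x0 //; lia.
Qed.

Lemma quadrant_count_rec :
  quadrant_count (2 * m) (2 * m).+1 (2 * m + i) =
  2 * quadrant_count m m.+1 i + quadrant_count m m.+1 i.+1 + (i == 1) + (i == 2).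
Proof.
rewrite {1}/quadrant_count (big_cat_nat _ (n := m)) /=; [|lia..].
rewrite (eq_big_nat _ _ (F2 := fun x =>
    \sum_(1 <= y < m.+1) (birth x y == Some (2 * m + i)) +
    \sum_(m.+1 <= y < (2 * m).+1) (birth x y == Some (2 * m + i)))); last first.
  by move=> x hx; rewrite -big_cat_nat //; lia.
rewrite big_split /= -/(quadrant_count _ _ _) count_base add0n count_nw.
rewrite (@eq_big_nat _ _ _ m _ _ (fun x =>
    \sum_(1 <= y < m) (birth x y == Some (2 * m + i)) +
    \sum_(m <= y < (2 * m).+1) (birth x y == Some (2 * m + i)))); last first.
  by move=> x hx; rewrite -big_cat_nat //; lia.
by rewrite big_split /= count_se count_ne; lia.
Qed.

End Recurrence.

(** * Signed cells and the toothpicks they represent *)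

Section Cells.
Local Open Scope ring_scope.

Definition cell : Type := (int * int)%type.
Definition cell_odd (p : cell) : bool := odd (`|p.1| + `|p.2|)%N.
Definition axis (b : bool) : cell := if b then (1, 0) else (0, 1).
Definition cell_birth (p : cell) : option nat := birth `|p.1| `|p.2|.

Lemma cell_oddD p b : cell_odd (p + axis b) = ~~ cell_odd p.
Proof. by case: p b => x y []; rewrite /cell_odd /=; lia. Qed.

Lemma cell_oddB p b : cell_odd (p - axis b) = ~~ cell_odd p.
Proof. by case: p b => x y []; rewrite /cell_odd /=; lia. Qed.

(** Absolute values carry the rule to all four quadrants; a sign at most swaps the two inputs, and
    [next_birth] is symmetric. *)
Lemma cell_birth_local r : r != 0 ->
  cell_birth r = next_birth (cell_birth (r - axis (~~ cell_odd r)))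
                            (cell_birth (r + axis (~~ cell_odd r))).
Proof.
case: r => x y; rewrite /cell_birth /cell_odd /= => r0.
rewrite birth_local; last first.
  have : (x, y) != (0, 0) by [].
  rewrite xpair_eqE; lia.
have dec (z : int) :
     absz (z - 1) = dec_abs (absz z) /\ absz (z + 1) = (absz z).+1
  \/ absz (z + 1) = dec_abs (absz z) /\ absz (z - 1) = (absz z).+1.
  by rewrite /dec_abs; lia.
case: ifP => _ /=; rewrite ?addr0 ?subr0.
  by have [[-> ->]|[-> ->]] := dec y; rewrite // next_birthC.
by have [[-> ->]|[-> ->]] := dec x; rewrite // next_birthC.
Qed.

Lemma cell_birth1 p n : cell_birth p = Some n -> (n <= 1)%N -> p = 0.
Proof.
case: p => x y; rewrite /cell_birth /= => h n1.
have y0 : `|y|%N = 0%N.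
  have [//|y0] := posnP (absz y); have := birth_gt1 y0 h; lia.
rewrite y0 in h.
have x0 : `|x|%N = 0%N.
  by have [//|x0] := posnP (absz x); rewrite birth_x0 in h.
by rewrite -[0]/(0, 0); congr pair; lia.
Qed.

Section Geometry.
Variable R : realFieldType.

(* The cell [p] of the doubled lattice as a point of the plane. *)
Definition half (p : cell) : point R := (p.1%:~R / 2, p.2%:~R / 2).
Definition place (p : cell) : toothpick R := (half p, ~~ cell_odd p).

Lemma halfD p q : half (p + q) = (half p + half q)%R :> R * R.
Proof. by rewrite /half /= !intrD !mulrDl. Qed.

Lemma halfB p q : half (p - q) = (half p - half q)%R :> R * R.
Proof. by rewrite /half /= !intrB !mulrBl. Qed.

Lemma half_inj : injective half.
Proof.
have h2 : (2 : R)^-1 != 0 by rewrite invr_eq0 pnatr_eq0.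
move=> [x y] [x' y'] [] /(mulIf h2) /intr_inj -> /(mulIf h2) /intr_inj -> //.
Qed.

Lemma place_inj : injective place.
Proof. by move=> p q [] *; apply: half_inj; congr pair. Qed.

Lemma half_axis p : half_vector (place p) = half (axis (cell_odd p)).
Proof.
by rewrite /half_vector /half /axis /=; case: cell_odd; rewrite /= mul0r mul1r.
Qed.

Lemma mem_ends_place p q : (half p \in ends (place q)) =
  (p == q - axis (cell_odd q)) || (p == q + axis (cell_odd q)).
Proof.
by rewrite /ends /midpoint /= half_axis -halfB -halfD !inE !(inj_eq half_inj).
Qed.

Lemma ends_placeP (v : point R) q : v \in ends (place q) ->
  exists2 r, v = half r &
             (r == q - axis (cell_odd q)) || (r == q + axis (cell_odd q)).
Proof.
rewrite /ends /midpoint /= half_axis -halfB -halfD !inE.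
by case/orP=> /eqP ->; [exists (q - axis (cell_odd q)) |
  exists (q + axis (cell_odd q))]; rewrite ?eqxx ?orbT.
Qed.

(** A unit step along an axis flips the parity, so being an end can be read from either cell. *)
Lemma end_of_inputs r q :
  (r == q - axis (cell_odd q)) || (r == q + axis (cell_odd q)) =
  (q == r - axis (~~ cell_odd r)) || (q == r + axis (~~ cell_odd r)).
Proof.
apply/idP/idP => /orP[] /eqP ->;
  by rewrite ?cell_oddB ?cell_oddD ?negbK ?addrK ?subrK eqxx ?orbT.
Qed.

Lemma sub_add_axis_neq (r : cell) b : r - axis b != r + axis b.
Proof.
by case: r b => x y []; apply/eqP => -[]; lia.
Qed.

Definition born (n : nat) (p : cell) : bool :=
  if cell_birth p is Some j then (j <= n)%N else false.

Lemma bornP n p : reflect (exists2 j, cell_birth p = Some j & (j <= n)%N) (born n p).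
Proof.
rewrite /born; case: (cell_birth p) => [j|]; last by constructor; case.
by apply: (iffP idP) => [|[i [->]]] //; exists j.
Qed.

Lemma next_birth_Some a b n : next_birth a b = Some n.+1 ->
  a = Some n /\ (forall j, b = Some j -> (n < j)%N) \/
  b = Some n /\ (forall j, a = Some j -> (n < j)%N).
Proof.
case: a b => [i|] [j|] //=; last 2 first.
- by case=> ->; left.
- by case=> ->; right.
case: ltngtP => //= ij [e]; [left|right]; split=> [|k [<-]]; try congr Some; lia.
Qed.

Lemma input_neq r b : (r - axis b != r) * (r + axis b != r).
Proof. by case: r b => x y []; split; apply/eqP => -[]; lia. Qed.

(** An end [r] of [q] is exposed when [r] itself and its other input are unborn at stage [n]. The
    local rule then dates [r] one stage after [q], and [r] being unborn forces [q] to be born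
    exactly at [n]. *)
Lemma new_toothpicksP (S : {fset toothpick R}) n : (0 < n)%N ->
  (forall s, reflect (exists2 p, born n p & s = place p) (s \in S)) ->
  forall s, reflect (exists2 p, cell_birth p = Some n.+1 & s = place p)
                    (s \in new_toothpicks S).
Proof.
move=> n0 memS s.
apply: (iffP (imfset2P _ _ _ _ _)).
  case=> s0 /= /memS[q bq ->] [v].
  rewrite inE /exposed => /andP[_ /andP[vq /allP vS]] ->.
  have [r vE] := ends_placeP vq; subst v => rq; exists r; last first.
    by rewrite /place /=; congr pair; case/orP: rq => /eqP ->;
      rewrite ?cell_oddD ?cell_oddB.
  move: rq; rewrite end_of_inputs => rq.
  have rS q' : born n q' -> q' != q -> (half r \notin ends (place q')) && (r != q').
    move=> bq' qq'; rewrite -(inj_eq half_inj); apply: (vS (place q')).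
    by rewrite !inE (inj_eq place_inj) qq' /=; apply/memS; exists q'.
  have rq_neq : r != q.
    by case/orP: rq => /eqP ->; rewrite eq_sym input_neq.
  have br : ~~ born n r by apply: contraL (eqxx r) => /rS /(_ rq_neq) /andP[].
  (* The origin is born at stage 1, hence by stage [n]. *)
  have r0 : r != 0 by apply: contraNneq br => ->.
  move: br; rewrite /born (cell_birth_local r0).
  have input_unborn q' : q' != q ->
      (q' == r - axis (~~ cell_odd r)) || (q' == r + axis (~~ cell_odd r)) ->
      forall j, cell_birth q' = Some j -> (n < j)%N.
    move=> qq' rq' j bj; rewrite ltnNge; apply/negP => jn.
    have /rS/(_ qq')/andP[] : born n q' by apply/bornP; exists j.
    by rewrite mem_ends_place end_of_inputs rq'.
  have [j bj jn] := bornP _ _ bq.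
  have finish q' : q' != q ->
      (q' == r - axis (~~ cell_odd r)) || (q' == r + axis (~~ cell_odd r)) ->
      next_birth (cell_birth q) (cell_birth q') = Some j.+1.
    move=> qq' rq'; rewrite bj next_birth_lt // => i bi.
    by apply: leq_ltn_trans jn _; apply: input_unborn bi.
  case/orP: rq => /eqP qE; move: finish; rewrite qE => finish.
    rewrite finish ?eqxx ?orbT // 1?eq_sym ?sub_add_axis_neq //.
    by move=> h; congr Some; lia.
  rewrite next_birthC finish ?eqxx ?orbT // ?sub_add_axis_neq //.
  by move=> h; congr Some; lia.
case=> r br ->.
have r_unborn : ~~ born n r by rewrite /born br -ltnNge.
have r0 : r != 0 by apply: contraNneq r_unborn => ->.
have exposed_at q q' : cell_odd q = ~~ cell_odd r ->
    (forall p, (half r \in ends (place p)) = (p == q) || (p == q')) ->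
    cell_birth q = Some n -> (forall j, cell_birth q' = Some j -> (n < j)%N) ->
    exists2 s, s \in S & exists2 v : point R,
      (v \in ends s) && exposed S s v & place r = (v, ~~ vertical s).
  move=> qr inputs bq bq'; exists (place q).
    by apply/memS; exists q; rewrite /born ?bq.
  exists (half r); last by rewrite /vertical /= qr negbK.
  have rq : half r \in ends (place q) by rewrite inputs eqxx.
  rewrite /exposed rq /=; apply/allP => s' /fsetD1P[s'q /memS[p bp s'E]].
  move: s'q; rewrite {s'}s'E (inj_eq place_inj) => pq.
  have [j bj jn] := bornP _ _ bp.
  rewrite inputs negb_or pq (inj_eq half_inj) /=; apply/andP; split.
    by apply/eqP => pq'; have := bq' j; rewrite -pq' bj ltnNge jn => /(_ erefl).
  by apply: contraTneq bp => <-.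
have ins p : (half r \in ends (place p)) =
    (p == r - axis (~~ cell_odd r)) || (p == r + axis (~~ cell_odd r)).
  by rewrite mem_ends_place end_of_inputs.
move: (br); rewrite (cell_birth_local r0) => /next_birth_Some[] [bq bq'].
  have [s0 ? [v]] := exposed_at _ _ (cell_oddB _ _) ins bq bq'.
  by exists s0 => //; exists v.
have [|s0 ? [v]] := exposed_at _ _ (cell_oddD _ _) _ bq bq'.
  by move=> p; rewrite ins orbC.
by exists s0 => //; exists v.
Qed.

Lemma structure_atP n s :
  reflect (exists2 p, born n p & s = place p) (s \in structure_at R n).
Proof.
elim: n s => [|n IH] s.
  rewrite inE; constructor=> -[p /bornP[j bj]]; rewrite leqn0 => /eqP j0.
  by have := birth_gt0 bj; rewrite j0.
have born1 p : born n.+1 p = born n p || (cell_birth p == Some n.+1).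
  rewrite /born; case: (cell_birth p) => // j.
  by rewrite leq_eqVlt orbC.
case: n IH born1 => [|n] IH born1 /=.
  rewrite inE; apply: (iffP eqP) => [->|[p /bornP[j /cell_birth1 p0 /p0 ->] ->]].
    by exists 0; rewrite // /place /half /= mul0r.
  by rewrite /place /half /= mul0r.
rewrite in_fsetU; apply: (iffP orP) => [[/IH[p bp ->]|]|[p]].
- by exists p; rewrite // born1 bp.
- case/(new_toothpicksP (ltn0Sn n) IH) => p bp ->; exists p => //.
  by rewrite born1 bp eqxx orbT.
rewrite born1 => /orP[bp|/eqP bp] ->.
  by left; apply/IH; exists p.
by right; apply/(new_toothpicksP (ltn0Sn n) IH); exists p.
Qed.

Lemma added_toothpicksP n s :
  reflect (exists2 p, cell_birth p = Some n.+1 & s = place p)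
          (s \in (structure_at R n.+1 `\` structure_at R n)%fset).
Proof.
rewrite in_fsetD; apply: (iffP andP) => [[old /structure_atP[p bp sE]]|[p bp ->]].
  exists p => //; have [j bj jn] := bornP _ _ bp.
  rewrite bj; congr Some; apply/eqP; rewrite eqn_leq jn ltnNge.
  apply: contraNN old => jn'; apply/structure_atP; exists p => //.
  by apply/bornP; exists j.
split; last by apply/structure_atP; exists p => //; apply/bornP; exists n.+1.
apply/structure_atP => -[q /bornP[j bj jn] /place_inj pq].
by move: bj; rewrite -pq bp => -[jE]; rewrite -jE ltnn in jn.
Qed.

Lemma t_small : t R 1 = 1%N /\ t R 2 = 2%N.
Proof.
have added n A :
    (forall s, reflect (exists2 p, cell_birth p = Some n.+1 & s = place p)
                       (s \in A)) ->
    t R n.+1 = #|` A|.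
  move=> memA; rewrite /t; congr #|` _|; apply/fsetP => s.
  by apply/added_toothpicksP/memA.
split.
  rewrite (@added _ [fset place 0]%fset) ?cardfs1 // => s.
  rewrite inE; apply: (iffP eqP) => [->|[p /cell_birth1 -> //]].
  by exists 0.
rewrite (@added _ [fset place (0, 1); place (0, -1)]%fset) => [|s].
  by rewrite cardfs2 (inj_eq place_inj).
rewrite !inE; apply: (iffP orP) => [[/eqP|/eqP] ->|[[x y] bp ->]].
- by exists (0, 1).
- by exists (0, -1).
rewrite !(inj_eq place_inj) !xpair_eqE; move: bp; rewrite /cell_birth /=.
have [y0|y0] := posnP (absz y).
  rewrite y0; have [->|x0] := posnP (absz x); first by [].
  by rewrite birth_x0.
have [x0|x0] := posnP (absz x); last by move=> /(birth_gt2 x0 y0).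
rewrite x0 birth0; case: ifP => // _ [y1].
by lia.
Qed.

End Geometry.

End Cells.

(** * From one quadrant to the whole plane *)

Section TotalCount.
Variables (R : realFieldType) (k n : nat).
Hypotheses (n_gt2 : 2 < n) (n_le : n <= 2 * 2 ^ k).

Let quarter : {set 'I_(2 ^ k).+1 * 'I_(2 ^ k).+1} :=
  [set u : 'I_(2 ^ k).+1 * 'I_(2 ^ k).+1 |
    [&& 0 < u.1, 0 < u.2 & birth u.1 u.2 == Some n]].

Let signed (b : bool) (x : nat) : int := ((-1) ^+ b * x%:Z)%R.

Let unfold_quarter (w : ('I_(2 ^ k).+1 * 'I_(2 ^ k).+1) * (bool * bool)) :
  toothpick R := place R (signed w.2.1 w.1.1, signed w.2.2 w.1.2).

Lemma card_quarter : #|quarter| = quadrant_count (2 ^ k) (2 ^ k).+1 n.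
Proof.
have m0 : 0 < 2 ^ k by rewrite expn_gt0.
(* The square box of [quarter] has one column more than the block, where all births come after stage
   [2 * 2 ^ k]. *)
rewrite -(@quadrant_count_stable k (2 ^ k).+1 (2 ^ k).+1) // /quadrant_count.
rewrite -sum1dep_card big_mkcond /= -(pair_big xpredT xpredT
  (fun x y : 'I_(2 ^ k).+1 =>
    if [&& 0 < x, 0 < y & birth x y == Some n] then 1 else 0)) /=.
rewrite -(big_mkord xpredT (fun x => \sum_(y < (2 ^ k).+1)
  if [&& 0 < x, 0 < y & birth x y == Some n] then 1 else 0)).
rewrite big_ltn // big1 // add0n; apply: eq_big_nat => x /andP[x0 _].
rewrite -(big_mkord xpredT (fun y =>
  if [&& 0 < x, 0 < y & birth x y == Some n] then 1 else 0)).
rewrite big_ltn // andbF add0n; apply: eq_big_nat => y /andP[y0 _].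
by rewrite x0 y0 /=; case: eqP.
Qed.

Let abs_signed b x : absz (signed b x) = x.
Proof. by rewrite /signed abszMsign. Qed.

Lemma unfold_quarter_inj : {in setX quarter setT &, injective unfold_quarter}.
Proof.
have signed_inj b b' x x' : 0 < x -> signed b x = signed b' x' -> b = b' /\ x = x'.
  by move=> x0; rewrite /signed; case: b b' => [] [] /=; lia.
move=> [[x y] [b c]] [[x' y'] [b' c']] /setXP[+ _] _ /place_inj.
rewrite inE /= => /and3P[x0 y0 _] [] /(signed_inj _ _ _ _ x0)[-> /val_inj ->].
by move=> /(signed_inj _ _ _ _ y0)[-> /val_inj ->].
Qed.

(** After stage 2 no cell on an axis is born, so the sign choices give four distinct cells for each
    cell of the open quadrant. *)
Lemma t_quadrant : t R n = 4 * quadrant_count (2 ^ k) (2 ^ k).+1 n.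
Proof.
have -> : t R n = #|` [fset unfold_quarter w | w in setX quarter setT]%fset|.
  have [n' nE] : exists n', n = n'.+1 by exists n.-1; lia.
  rewrite {1}nE /t; congr #|` _|; apply/fsetP => s.
  apply/added_toothpicksP/imfsetP; rewrite -nE.
    case=> -[x y]; rewrite /cell_birth /= => bp ->.
    have x0 : 0 < absz x.
      by case: posnP bp => // ->; rewrite birth0; case: ifP => // y1 [] yn; lia.
    have y0 : 0 < absz y by case: posnP bp => // ->; rewrite birth_x0.
    have small : ~~ ((2 ^ k <= absz x) || (2 ^ k < absz y)).
      by apply/negP => /(birth_gt x0 y0)/(_ bp); lia.
    exists ((inord (absz x), inord (absz y)), (x < 0, y < 0)%R).
      by rewrite inE /= !inE /= !inordK ?x0 ?y0 ?bp ?eqxx //; lia.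
    by rewrite /unfold_quarter /signed /= !inordK -?intEsign //; lia.
  case=> -[[x y] [b c]] /= /setXP[]; rewrite inE => /and3P[_ _ /eqP bp] _ ->.
  by eexists; last reflexivity; rewrite /cell_birth !abs_signed.
rewrite card_in_imfset /=; last exact: unfold_quarter_inj.
by rewrite -cardE cardsX cardsT card_prod card_bool card_quarter mulnC.
Qed.
End TotalCount.

(** * The recurrence for [t] *)

(** The correction terms are the axis cells: the origin at stage 1 and [(0, 1)], [(0, -1)] at stage
    2. *)
Lemma t_quadrant_count (R : realFieldType) k n : n <= 2 * 2 ^ k ->
  t R n = 4 * quadrant_count (2 ^ k) (2 ^ k).+1 n + (n == 1) + 2 * (n == 2).
Proof.
case: n => [|[|[|n]]] hn; last by rewrite (t_quadrant R _ hn) ?addn0.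
- by rewrite quadrant_count_small.
- by rewrite quadrant_count_small // (t_small R).1.
- by rewrite quadrant_count_small // (t_small R).2.
Qed.

Lemma t_pow2_add (R : realFieldType) k i : 0 < i < 2 * 2 ^ k ->
  t R (2 * 2 ^ k + i) = 2 * t R i + t R i.+1.
Proof.
move=> /andP[i0 hi]; have m0 : 0 < 2 ^ k by rewrite expn_gt0.
rewrite (@t_quadrant_count R k.+1) ?expnS; last by lia.
rewrite quadrant_count_rec // !(@t_quadrant_count R k); [|lia..].
have [i1 i2] : (2 * 2 ^ k + i == 1) = false /\ (2 * 2 ^ k + i == 2) = false by lia.
(* For [i = 1] the axis terms of [t R 1] and [t R 2] add up to 4, and for [i = 2] doubling that of
   [t R 2] gives 4: four times the corner terms of [quadrant_count_rec]. *)
rewrite i1 i2; lia.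
Qed.

Lemma t_pow2 (R : realFieldType) k : t R (2 ^ k.+1) = 2 ^ k.+1.
Proof.
elim: k => [|k IH]; first by rewrite (t_small R).2.
have m0 : 0 < 2 ^ k by rewrite expn_gt0.
have -> : 2 ^ k.+2 = 2 * 2 ^ k + 2 ^ k.+1 by rewrite !expnS; lia.
rewrite (@t_quadrant_count R k.+1); last by rewrite !expnS; lia.
rewrite {1 2}expnS quadrant_count_rec ?expn_gt0 //.
(* With [i = 2m] the stage [i + 1] is past every birth in the block, so the third copy contributes
   nothing and [t] just doubles. *)
rewrite (_ : quadrant_count _ _ _.+1 = 0); last first.
  rewrite /quadrant_count big_nat_cond big1 // => x hx.
  rewrite big_nat_cond big1 // => y hy.
  by case: eqP => // /(@birth_le k); rewrite expnS; lia.
move: IH; rewrite (@t_quadrant_count R k) ?expnS //.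
have [i1 i2] : (2 * 2 ^ k + 2 * 2 ^ k == 1) = false /\
  (2 * 2 ^ k + 2 * 2 ^ k == 2) = false by lia.
rewrite i1 i2; lia.
Qed.

Theorem theorem2 (R : realFieldType) :
  t R 1 = 1 /\
  forall k : nat, 1 <= k ->
  forall i : nat, i <= 2 ^ k - 1 ->
    t R (2 ^ k + i) = if i == 0 then 2 ^ k else 2 * t R i + t R (i + 1).
Proof.
split; first exact: (t_small R).1.
case=> // k _ i hi; have [->|i0] := posnP i; first by rewrite addn0 t_pow2.
rewrite addn1 expnS t_pow2_add // i0 -expnS /=.
by move: (expn_gt0 2 k.+1) => /=; lia.
Qed.
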